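(* Let $k\ge1$ be a fixed constant and let $\mathcal P:\{0,1\}^{\binom nk}\to\{0,1\}$ be a non-constant $k$-uniform hypergraph property on vertex set $[n]$. Let $M(\mathcal P)=\max\{\mathsf N(\mathcal P),\mathsf N(\overline{\mathcal P})\}$. Then $M(\mathcal P)\ge\Omega(n^{1/6})$.
   Context: $k$-uniform hypergraphs on vertex set $[n]=\{1,\dots,n\}$ are identified with $\{0,1\}^{\binom nk}$ (one coordinate per $k$-subset, indicating whether it is a hyperedge). A $k$-uniform hypergraph property is a function $\mathcal P$ on such hypergraphs with $\mathcal P(H_1)=\mathcal P(H_2)$ whenever $H_1,H_2$ are isomorphic (related by a permutation of $[n]$). $\mathsf N(g)$ is the minimum degree of a real polynomial $p$ with $|p(x)|\le1/3$ whenever $g(x)=0$ and $|p(x)|\ge1$ whenever $g(x)=1$; $\overline{\mathcal P}=1-\mathcal P$. The constant in $\Omega(\cdot)$ may depend on $k$. *)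

(* Defs.v *)
From Stdlib Require Import Reals.
From HB Require Import structures.
From mathcomp Require Import all_boot all_order all_algebra all_fingroup.
From mathcomp Require Import mpoly.
From mathcomp Require Import Rstruct.
Set Implicit Arguments. Unset Strict Implicit. Unset Printing Implicit Defensive.
Import Order.TTheory GRing.Theory Num.Theory.

Definition ksub (n k : nat) := {A : {set 'I_n} | #|A| == k}.

Definition hypergraph (n k : nat) := {ffun ksub n k -> bool}.

Lemma card_perm_ksub n k (s : {perm 'I_n}) (e : ksub n k) : #|s @: val e| == k.
Proof. by rewrite card_imset; [exact: (valP e) | exact: perm_inj]. Qed.

Definition ksub_perm n k (s : {perm 'I_n}) (e : ksub n k) : ksub n k :=
  exist _ (s @: val e) (card_perm_ksub s e).

Definition hg_iso n k (H1 H2 : hypergraph n k) : Prop :=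
  exists s : {perm 'I_n}, forall e : ksub n k, H1 e = H2 (ksub_perm s e).

Definition hg_property n k (P : hypergraph n k -> bool) : Prop :=
  forall H1 H2, hg_iso H1 H2 -> P H1 = P H2.

Definition nonconstant n k (P : hypergraph n k -> bool) : Prop :=
  exists H1 H2, P H1 != P H2.

Definition nvars n k := #|{: ksub n k}|.

Definition hg_point n k (H : hypergraph n k) : 'I_(nvars n k) -> R :=
  fun i => ((H (enum_val i) : nat)%:R)%R.

(* total degree of a real multivariate polynomial (msize = 1 + degree) *)
Definition mdegree m (p : {mpoly R[m]}) : nat := (msize p).-1.

Definition Nrepr n k (g : hypergraph n k -> bool) (p : {mpoly R[nvars n k]}) : Prop :=
  forall H : hypergraph n k,
    if g H then (1 <= `|p.@[hg_point H]|)%R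
    else (`|p.@[hg_point H]| <= 1 / 3%:R)%R.

Definition is_N n k (g : hypergraph n k -> bool) (d : nat) : Prop :=
  (exists p, Nrepr g p /\ mdegree p = d) /\
  (forall p, Nrepr g p -> (d <= mdegree p)%N).

(* Main.v *)
(** Write [M] for the larger of the two degrees.  Squaring and averaging over the
    permutations of [m] bits turns polynomials for a property, along an embedding
    of the [m]-cube on which the property is symmetric, into univariate [Q] of
    degree at most [2M] with [Q j >= 1] or [0 <= Q j <= 1/9] for [j = 0, ..., m]
    according to the value at weight [j], and likewise for the complement.

    Interpolation at the nodes [1] and [4 i^2] shows that a polynomial of degree
    at most [t] with values at most [1/9] at [1, ..., 4 t^2] is below [1] at [0].
    So, with [t = 2M + 1], a value of the symmetric function cannot be followed by
    [4 t^2] copies of the opposite value.  Two consequences: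
    - an inclusion-minimal [G] with [P G <> P hg0] has fewer than [4 t^2] edges,
      since below [G] the property is an OR of the edge deletions;
    - a symmetric function with different values at [0] and [1] is non-constant on
      each window of [4 t^2] consecutive weights, so that [Q - 1/2] has a root in
      each window, whence [m < (t + 1) 4 t^2].

    The minimal [G] touches at most [4 k t^2] vertices, so about [n / (4 k t^2)]
    vertex-disjoint copies of it fit into [n] vertices.  The property of a union
    of some of these copies depends only on their number and differs for zero and
    one copy.  Therefore [n < 32 k t^5], which is stronger than needed. *)
Require Import Defs.
From Stdlib Require Import Reals.
From HB Require Import structures.
From mathcomp Require Import all_boot all_order all_algebra all_fingroup.
From mathcomp Require Import mpoly.
From mathcomp Require Import Rstruct.
From mathcomp Require Import qpoly ring lra zify.
From Stdlib Require Import Classical_Prop.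
Set Implicit Arguments. Unset Strict Implicit. Unset Printing Implicit Defensive.
Import Order.TTheory GRing.Theory Num.Theory.

(** * Polynomials small on an initial segment *)

Section PolynomialGap.
Local Open Scope ring_scope.
Variable F : rcfType.

(** Node 1 stands in for the evaluation point 0; the quadratic growth of the other nodes keeps the
    total Lagrange weight at 0 bounded independently of [t]. *)
Definition gap_node (i : nat) : F := (if i == 0 then 1 else 4 * i ^ 2)%N%:R.

Lemma gap_node_inj : injective gap_node.
Proof.
move=> i j /eqP; rewrite eqr_nat; case: i j => [|i] [|j] //= /eqP; try lia.
by move/eqP; rewrite eqn_pmul2l // eqn_sqr => /eqP.
Qed.

Lemma fact_mul_le (t i : nat) : (i <= t)%N -> (t`! * t`! <= (t - i)`! * (t + i)`!)%N.
Proof.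
elim: i => [|i IH] lit; first by rewrite subn0 addn0.
apply: leq_trans (IH (ltnW lit)) _.
rewrite -(subnSK lit) addnS !factS (mulnCA (t - i.+1)`!) mulnA.
by rewrite !leq_mul2r; apply/orP; right; apply/orP; right; lia.
Qed.

(** Factor [i^2 - j^2 = (i - j) (i + j)]: the first factors together with the extra [i] give [i!],
    and the second ones continue it up to [(2 i - 1)!]. *)
Lemma prod_diff_sqr_lt (i : nat) : (0 < i)%N ->
  (\prod_(1 <= j < i) (i ^ 2 - j ^ 2) * i = (i + i).-1`!)%N.
Proof.
case: i => // i _.
have -> : (i.+1 + i.+1).-1 = (i.+1 + i)%N by lia.
rewrite (eq_big_nat _ _ (F2 := fun j => ((i.+1 - j) * (i.+1 + j))%N)); last first.
  by move=> j _; rewrite subn_sqr.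
rewrite big_split /= big_nat_rev /= (eq_big_nat _ _ (F2 := id)); last first.
  by move=> j; lia.
rewrite mulnAC.
have -> : (\prod_(1 <= j < i.+1) j * i.+1 = (i.+1)`!)%N.
  by rewrite factS fact_prod mulnC.
have gen l : ((i.+1)`! * \prod_(1 <= j < l.+1) (i.+1 + j) = (i.+1 + l)`!)%N.
  elim: l => [|l IH]; first by rewrite big_geq // muln1 addn0.
  by rewrite big_nat_recr //= mulnA IH addnS factS mulnC.
exact: gen.
Qed.

(** Induction on [t] starting from [t = i], where [prod_diff_sqr_lt] applies; each further step
    brings the factor [(t + 1)^2 / ((t + 1 - i) (t + 1 + i))]. *)
Lemma prod_sqr_ratio_eq (i t : nat) : (0 < i <= t)%N ->
  \prod_(1 <= j < t.+1 | j != i) ((j ^ 2)%:R / `|(j ^ 2)%:R - (i ^ 2)%:R| : F)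
  * ((t - i)`! * (t + i)`!)%:R = 2 * (t`! * t`!)%:R.
Proof.
case/andP=> i_gt0; elim: t => [|t IH]; first by lia.
rewrite leq_eqVlt => /orP[/eqP <-{t IH}|lit].
  rewrite big_mkcond big_nat_recr //= eqxx mulr1.
  rewrite (eq_big_nat _ _ (F2 := fun j => j%:R ^+ 2 / (i ^ 2 - j ^ 2)%:R)); last first.
    move=> j /andP[j_gt0 ltji]; rewrite (_ : j != i); last by lia.
    by rewrite distrC -natrB ?leq_sqr 1?ltnW // normr_nat natrX.
  have := prod_diff_sqr_lt i_gt0.
  rewrite prodf_div /= subnn fact0 mul1n -[(i + i)%N]prednK ?addn_gt0 ?i_gt0 // factS => <-.
  rewrite prodrXl -!natr_prod -[in X in X ^+ 2](prednK i_gt0) -fact_prod.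
  have -> : ((i + i).-1.+1 = 2 * i)%N by lia.
  have -> : (i`! = i * (i.-1)`!)%N by rewrite -[in LHS](prednK i_gt0) factS prednK.
  have : (\prod_(1 <= j < i) (i ^ 2 - j ^ 2))%:R != 0 :> F.
    rewrite pnatr_eq0 -lt0n big_nat_cond prodn_cond_gt0 // => j /andP[/andP[j_gt0 ltji] _].
    by rewrite subn_gt0 ltn_sqr.
  rewrite !(natrM, natrX, natrD) => nz; field.
  exact: nz.
rewrite big_mkcond big_nat_recr //= -big_mkcond /=.
have -> : t.+1 != i by lia.
have {}IH := IH lit.
rewrite ger0_norm; last by rewrite subr_ge0 ler_nat leq_sqr; lia.
rewrite subSn // addSn !factS.
have nz1 : (t.+1)%:R - i%:R != 0 :> F by rewrite -natrB ?pnatr_eq0; lia.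
have nz2 : (t.+1)%:R + i%:R != 0 :> F by rewrite -natrD pnatr_eq0; lia.
rewrite mulnACA natrM [RHS](_ : _ = (t.+1 ^ 2)%:R * (2 * (t`! * t`!)%:R)); last first.
  rewrite !(natrM, natrX); ring.
rewrite -IH -subSn // -addSn !(natrM, natrX, natrD) natrB 1?ltnW //; field.
by rewrite nat1r subr_sqr mulf_neq0.
Qed.

Lemma prod_sqr_ratio_le (i t : nat) : (0 < i <= t)%N ->
  \prod_(1 <= j < t.+1 | j != i) ((j ^ 2)%:R / `|(j ^ 2)%:R - (i ^ 2)%:R| : F) <= 2.
Proof.
move=> it; have /andP[_ leit] := it.
have fact_pos : 0 < ((t - i)`! * (t + i)`!)%:R :> F.
  by rewrite ltr0n muln_gt0 !fact_gt0.
rewrite -(ler_pM2r fact_pos) prod_sqr_ratio_eq // ler_pM2l //.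
by rewrite ler_nat fact_mul_le.
Qed.

(* The partial products of Wallis' product for pi / 2. *)
Lemma wallis_partial_le (t : nat) :
  \prod_(1 <= j < t.+1) ((4 * j ^ 2)%:R / ((4 * j ^ 2)%:R - 1) : F) <= 2 - t.+1%:R^-1.
Proof.
elim: t => [|t IH]; first by rewrite big_geq // invr1; lra.
rewrite big_nat_recr //=.
have pos : 0 < (4 * t.+1 ^ 2)%:R - 1 :> F by rewrite subr_gt0 ltr1n; lia.
apply: le_trans (ler_wpM2r _ IH) _; first by rewrite divr_ge0 // ltW.
rewrite mulrA ler_pdivrMr //.
rewrite !(natrM, natrX) -(natr1 t.+1).
have : 1 <= t.+1%:R :> F by rewrite ler1n.
move: (t.+1%:R : F) => s s_ge1.
rewrite -subr_ge0 [X in 0 <= X](_ : _ = (2 * s - 1) / (s + 1)); last first.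
  by field; apply/andP; split; apply: lt0r_neq0; lra.
by rewrite divr_ge0 //; lra.
Qed.

(** The sum telescopes: [2 / (4 i^2 - 1) = 1 / (2 i - 1) - 1 / (2 i + 1)]. *)
Lemma inv_sqr_sum_le (t : nat) :
  \sum_(1 <= i < t.+1) (((4 * i ^ 2)%:R - 1)^-1 * 2 : F) <= 1 - (2 * t + 1)%:R^-1.
Proof.
elim: t => [|t IH]; first by rewrite big_geq // invr1; lra.
rewrite big_nat_recr //=; apply: le_trans (lerD IH (lexx _)) _.
rewrite le_eqVlt; apply/orP; left; apply/eqP.
rewrite !(natrM, natrX, natrD) -(natr1 t).
have : 0 <= t%:R :> F by [].
move: (t%:R : F) => s s_ge0; field.
by rewrite !lt0r_neq0 //; nra.
Qed.

(** All nodes lie where [Q] is small, and the absolute Lagrange weights at 0 sum to at most 3: at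
    most 2 from node 1 and at most 1 from all the others. Hence the bound [3 / 9 < 1]. *)
Lemma poly_gap (t : nat) (Q : {poly F}) : (0 < t)%N -> (size Q <= t.+1)%N ->
  (forall j, (0 < j <= 4 * t ^ 2)%N -> `|Q.[j%:R]| <= 1 / 9) -> `|Q.[0]| < 1.
Proof.
move=> t_gt0 sizeQ smallQ.
rewrite [Q](lagrange_gen (ltn0Sn t) gap_node_inj sizeQ) horner_sum.
apply: le_lt_trans (ler_norm_sum _ _ _) _.
(* [w i] is the absolute value at 0 of the [i]-th Lagrange basis polynomial. *)
pose w (i : nat) : F := \prod_(0 <= j < t.+1 | j != i)
  (gap_node j / `|gap_node j - gap_node i|).
have node_ge0 j : 0 <= gap_node j by [].
have termE (i : 'I_t.+1) :
    `|(Q.[gap_node i]%:P * tnth (lagrange t.+1 gap_node) i).[0]| <= 1 / 9 * w i.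
  rewrite lagrangeE //=; last exact: gap_node_inj.
  rewrite hornerM hornerC hornerM hornerC normrM ler_pM //.
    rewrite /gap_node; apply: smallQ; case: ifP; first by lia.
    by case: i => i /= ? ?; rewrite leq_mul2l leq_sqr; lia.
  rewrite normrM normfV !horner_prod !normr_prod /w big_mkord -prodfV -big_split /=.
  under eq_bigr => j _ do
    rewrite !hornerXsubC sub0r normrN (ger0_norm (node_ge0 _)) mulrC distrC.
  exact: lexx.
apply: le_lt_trans (ler_sum _ (fun i _ => termE i)) _.
rewrite -mulr_sumr -(big_mkord xpredT w) big_ltn //.
have node0 : gap_node 0 = 1 by [].
have nodeS j : (0 < j)%N -> gap_node j = (4 * j ^ 2)%:R by case: j.
have node_gt1 j : (0 < j)%N -> 0 < gap_node j - 1.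
  by move=> j_gt0; rewrite nodeS // subr_gt0 ltr1n; nia.
have w0 : w 0%N <= 2.
  rewrite /w big_ltn_cond //= big_mkcond.
  rewrite (eq_big_nat _ _ (F2 := fun j => (4 * j ^ 2)%:R / ((4 * j ^ 2)%:R - 1))).
    by apply: le_trans (wallis_partial_le t) _; rewrite gerBl invr_ge0.
  move=> j /andP[j_gt0 _]; rewrite -lt0n j_gt0 node0 ger0_norm ?nodeS //.
  by rewrite -nodeS // ltW // node_gt1.
have wS : \sum_(1 <= i < t.+1) w i <= 1.
  apply: le_trans (_ : 1 - (2 * t + 1)%:R^-1 <= 1); last by rewrite gerBl invr_ge0.
  apply: le_trans (inv_sqr_sum_le t).
  rewrite big_nat_cond [leRHS]big_nat_cond; apply: ler_sum => i /andP[/andP[i_gt0 leit] _].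
  (* Node 1 contributes the factor [1 / (4 i^2 - 1)]; in the remaining product the factors 4 cancel,
     and [prod_sqr_ratio_le] bounds it by 2. *)
  rewrite /w big_ltn_cond //= eq_sym -lt0n i_gt0 node0 distrC.
  rewrite gtr0_norm ?node_gt1 // mul1r -nodeS //.
  apply: ler_wpM2l; first by rewrite invr_ge0 ltW // node_gt1.
  apply: le_trans (_ : _ <= _) (prod_sqr_ratio_le (i := i) (t := t) _); last by rewrite i_gt0.
  rewrite le_eqVlt; apply/orP; left; apply/eqP.
  rewrite big_nat_cond [RHS]big_nat_cond; apply: eq_bigr => j /andP[/andP[j_gt0 _] _].
  rewrite !nodeS // !natrM -mulrBr normrM normr_nat invfM mulrACA divff ?mul1r //.
  by rewrite pnatr_eq0.
move: w0 wS; lra.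
Qed.

End PolynomialGap.

(** * Symmetrization *)

Section Symmetrization.
Local Open Scope ring_scope.
Variables (F : rcfType) (m : nat).
Implicit Types (f g : {set 'I_m} -> F) (d : nat).

(** Bits satisfy [x^2 = x], so multilinear polynomials suffice on the cube; the monomial with
    variable set [T] takes the value [T \subset S] at the indicator of [S]. *)
Definition set_degree d f := exists c : {set 'I_m} -> F,
  forall S, f S = \sum_(T : {set 'I_m} | (#|T| <= d)%N) c T * (T \subset S)%:R.

Lemma set_degree_eq d f g : f =1 g -> set_degree d f -> set_degree d g.
Proof. by move=> fg [c cE]; exists c => S; rewrite -fg. Qed.

Lemma set_degree_le d1 d2 f : (d1 <= d2)%N -> set_degree d1 f -> set_degree d2 f.
Proof.
move=> le12 [c cE]; exists (fun T : {set 'I_m} => if (#|T| <= d1)%N then c T else 0) => S.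
rewrite cE big_mkcond [RHS]big_mkcond; apply: eq_bigr => T _.
by case: leqP => [/leq_trans->//|_]; rewrite mul0r if_same.
Qed.

Lemma set_degree_subset d (T : {set 'I_m}) :
  (#|T| <= d)%N -> set_degree d (fun S => (T \subset S)%:R).
Proof.
move=> leTd; exists (fun T' : {set 'I_m} => (T' == T)%:R) => S.
rewrite (bigD1 T) //= eqxx mul1r big1 ?addr0 // => T' /andP[_ /negPf->].
by rewrite mul0r.
Qed.

Lemma set_degreeD d f g :
  set_degree d f -> set_degree d g -> set_degree d (fun S => f S + g S).
Proof.
move=> [c cE] [c' cE']; exists (fun T => c T + c' T) => S.
by rewrite cE cE' -big_split; apply: eq_bigr => T _; rewrite mulrDl.
Qed.

Lemma set_degreeZ d a f : set_degree d f -> set_degree d (fun S => a * f S).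
Proof.
move=> [c cE]; exists (fun T => a * c T) => S.
by rewrite cE mulr_sumr; apply: eq_bigr => T _; rewrite mulrA.
Qed.

Lemma set_degree_const d a : set_degree d (fun=> a).
Proof.
apply: set_degree_eq (set_degreeZ a (set_degree_subset (T := set0) _)).
  by move=> S; rewrite sub0set mulr1.
by rewrite cards0.
Qed.

Lemma set_degree_sum (I : eqType) (r : seq I) (P : pred I) d
    (f : I -> {set 'I_m} -> F) :
  (forall i, i \in r -> P i -> set_degree d (f i)) ->
  set_degree d (fun S => \sum_(i <- r | P i) f i S).
Proof.
elim: r => [|i r IH] degf.
  by apply: set_degree_eq (set_degree_const d 0) => S; rewrite big_nil.
have {}IH : set_degree d (fun S => \sum_(i <- r | P i) f i S).
  by apply: IH => j rj; apply: degf; rewrite in_cons rj orbT.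
case Pi: (P i); last by apply: set_degree_eq IH => S; rewrite big_cons Pi.
have := set_degreeD (degf i (mem_head _ _) Pi) IH.
by apply: set_degree_eq => S; rewrite big_cons Pi.
Qed.

(** Bits being idempotent, the monomials of [T] and [T'] multiply to that of [T :|: T']. *)
Lemma set_degreeM d1 d2 f g : set_degree d1 f -> set_degree d2 g ->
  set_degree (d1 + d2) (fun S => f S * g S).
Proof.
move=> [c cE] [c' cE'].
pose h (S : {set 'I_m}) := \sum_(T : {set 'I_m} | (#|T| <= d1)%N)
  \sum_(T' : {set 'I_m} | (#|T'| <= d2)%N) (c T * c' T') * (T :|: T' \subset S)%:R.
apply: (@set_degree_eq _ h).
  move=> S; rewrite cE cE' mulr_suml; apply: eq_bigr => T _.
  rewrite mulr_sumr; apply: eq_bigr => T' _.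
  by rewrite subUset -mulnb natrM mulrACA.
apply: set_degree_sum => T _ leT; apply: set_degree_sum => T' _ leT'.
apply: set_degreeZ; apply: set_degree_subset.
by rewrite cardsU; apply: leq_trans (leq_subr _ _) (leq_add leT leT').
Qed.

Lemma set_degreeX d f n : set_degree d f -> set_degree (d * n) (fun S => f S ^+ n).
Proof.
move=> degf; elim: n => [|n IH]; first exact: set_degree_const.
rewrite mulnS; apply: set_degree_eq (set_degreeM degf IH) => S.
by rewrite exprS.
Qed.

Lemma set_degree_prod (I : Type) (r : seq I) (d : I -> nat) (f : I -> {set 'I_m} -> F) :
  (forall i, set_degree (d i) (f i)) ->
  set_degree (\sum_(i <- r) d i) (fun S => \prod_(i <- r) f i S).
Proof.
move=> degf; elim: r => [|i r IH].
  by apply: set_degree_eq (set_degree_const _ 1) => S; rewrite big_nil.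
rewrite big_cons; apply: set_degree_eq (set_degreeM (degf i) IH) => S.
by rewrite big_cons.
Qed.

Lemma set_degree_meval (N : nat) (p : {mpoly F[N]}) (x : {set 'I_m} -> 'I_N -> F) :
  (forall e, set_degree 1 (fun S => x S e)) ->
  set_degree (msize p).-1 (fun S => p.@[x S]).
Proof.
move=> degx; pose f S := \sum_(mu <- msupp p) p@_mu * \prod_i x S i ^+ mu i.
apply: (@set_degree_eq _ f) => [S|]; first by rewrite mevalE.
apply: set_degree_sum => mu mu_p _; apply: set_degreeZ.
apply: (@set_degree_le (mdeg mu)).
  by have := msize_mdeg_lt mu_p; lia.
rewrite mdegE; apply: set_degree_prod => i.
by have := set_degreeX (mu i) (degx i); rewrite mul1n.
Qed.

Lemma set_degree_subset_fun d (T : {set 'I_m}) (h : bool -> F) :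
  (#|T| <= d)%N -> set_degree d (fun S => h (T \subset S)).
Proof.
move=> leTd; apply: set_degree_eq (set_degreeD (set_degree_const d (h false))
  (set_degreeZ (h true - h false) (set_degree_subset leTd))) => S.
by case: (T \subset S); rewrite ?mulr1 ?mulr0 ?addr0 // addrC subrK.
Qed.

(** The complements of these sets are the [(m - j)]-subsets of [~: T]. Choosing [m - j] rather than
    [j - #|T|] elements gives the correct value 0 for [j < #|T|] despite truncated subtraction. *)
Lemma card_supersets (T : {set 'I_m}) (j : nat) : (j <= m)%N ->
  #|[set S : {set 'I_m} | (T \subset S) && (#|S| == j)]| = 'C(m - #|T|, m - j).
Proof.
move=> lejm; have := cards_draws (~: T) (m - j)%N.
rewrite [#|~: T|]cardsCs setCK card_ord => <-.
rewrite -(card_imset _ (@setC_inj 'I_m)); apply: eq_card => S.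
rewrite -[S in LHS]setCK (mem_imset _ _ (@setC_inj _)) !inE subsetC.
rewrite [#|~: S|]cardsCs setCK card_ord; congr (_ && _).
by have := subset_leq_card (subsetT S); rewrite cardsT card_ord; lia.
Qed.

Lemma ffact_mul_bin (t j : nat) : (t <= m)%N -> (j <= m)%N ->
  (m ^_ t * 'C(m - t, m - j) = 'C(m, j) * j ^_ t)%N.
Proof.
move=> letm lejm; case: (leqP t j) => [letj|ltjt]; last first.
  by rewrite (ffact_small ltjt) bin_small ?muln0 //; lia.
apply/eqP; rewrite -(eqn_pmul2r (_ : 0 < (m - j)`! * (j - t)`!)%N); last first.
  by rewrite muln_gt0 !fact_gt0.
have -> : (j - t = m - t - (m - j))%N by lia.
rewrite -mulnA bin_fact; last by lia.
rewrite ffact_fact //.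
have -> : (m - t - (m - j) = j - t)%N by lia.
by rewrite (mulnC (m - j)`!) -mulnA (mulnA (j ^_ t)) ffact_fact // bin_fact.
Qed.

(** A uniformly random [j]-set contains [T] with probability [j ^_ t / m ^_ t], where [t = #|T|],
    and the falling factorial is a polynomial in [j] of degree [t]. *)
Lemma avg_subset (T : {set 'I_m}) : exists2 Q : {poly F}, (size Q <= #|T|.+1)%N &
  forall j, (j <= m)%N ->
  \sum_(S : {set 'I_m} | #|S| == j) (T \subset S)%:R = 'C(m, j)%:R * Q.[j%:R].
Proof.
have letm : (#|T| <= m)%N by rewrite -[leqRHS]card_ord max_card.
exists ((m ^_ #|T|)%:R^-1 *: \prod_(i < #|T|) ('X - i%:R%:P)).
  by rewrite (leq_trans (size_scale_leq _ _)) // size_prod_XsubC /index_enum -enumT size_enum_ord.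
move=> j lejm; rewrite hornerZ.
have -> : (\prod_(i < #|T|) ('X - i%:R%:P)).[j%:R] = (j ^_ #|T|)%:R :> F.
  rewrite horner_prod; elim: #|T| => [|t IH]; first by rewrite big_ord0 ffactn0.
  rewrite big_ord_recr /= IH hornerXsubC ffactnSr natrM.
  case: (leqP t j) => [letj|ltjt]; first by rewrite natrB.
  by rewrite ffact_small // !mul0r.
rewrite -natr_sum mulrCA -natrM -ffact_mul_bin // natrM mulKf; last first.
  by rewrite pnatr_eq0 -lt0n ffact_gt0.
rewrite -card_supersets // -sum1_card big_mkcond [in RHS]big_mkcond; congr (_%:R).
by apply: eq_bigr => S _; rewrite inE; case: (T \subset S); case: (_ == _).
Qed.

Lemma avg_poly d f : set_degree d f -> exists2 Q : {poly F}, (size Q <= d.+1)%N &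
  forall j, (j <= m)%N ->
  \sum_(S : {set 'I_m} | #|S| == j) f S = 'C(m, j)%:R * Q.[j%:R].
Proof.
move=> [c cE].
(* The sum over all [T] is generalized to a sum over a list, so that induction adds one monomial at
   a time. *)
have avg_seq (r : seq {set 'I_m}) : exists2 Q : {poly F}, (size Q <= d.+1)%N &
    forall j, (j <= m)%N ->
    \sum_(S : {set 'I_m} | #|S| == j) \sum_(T <- r | (#|T| <= d)%N) c T * (T \subset S)%:R
    = 'C(m, j)%:R * Q.[j%:R]; last first.
  have [Q sizeQ QE] := avg_seq (index_enum _).
  by exists Q => // j lejm; rewrite -QE // (eq_bigr _ (fun S _ => cE S)).
elim: r => [|T r [Q sizeQ QE]].
  exists 0; first by rewrite size_poly0.
  by move=> j _; rewrite horner0 mulr0 big1 // => S _; rewrite big_nil.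
case: (leqP #|T| d) => [leTd|ltdT]; last first.
  exists Q => // j lejm; rewrite -QE //; apply: eq_bigr => S _.
  by rewrite big_cons leqNgt ltdT.
have [Q' sizeQ' QE'] := avg_subset T.
exists (c T *: Q' + Q).
  rewrite (leq_trans (size_polyD _ _)) // geq_max sizeQ andbT.
  by rewrite (leq_trans (size_scale_leq _ _)) // (leq_trans sizeQ').
move=> j lejm; rewrite hornerD hornerZ mulrDr mulrCA -QE // -QE' //.
rewrite mulr_sumr -big_split; apply: eq_bigr => S _ /=.
by rewrite big_cons leTd.
Qed.

(** The value of [Q] at [j] is the average of [f] over the sets of size [j], and an average inherits
    pointwise one-sided bounds. *)
Lemma symmetrize d f : set_degree d f -> exists2 Q : {poly F}, (size Q <= d.+1)%N &
  forall (j : nat) (a : F), (j <= m)%N ->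
  ((forall S : {set 'I_m}, #|S| = j -> a <= f S) -> a <= Q.[j%:R]) /\
  ((forall S : {set 'I_m}, #|S| = j -> f S <= a) -> Q.[j%:R] <= a).
Proof.
move=> /avg_poly[Q sizeQ QE]; exists Q => // j a lejm.
have sumE : \sum_(S : {set 'I_m} | #|S| == j) a = 'C(m, j)%:R * a.
  rewrite sumr_const mulr_natl -[in RHS](card_ord m) -card_draws; congr (_ *+ _).
  by apply: eq_card => S; rewrite inE.
have pos : 0 < 'C(m, j)%:R :> F by rewrite ltr0n bin_gt0.
split=> bound; rewrite -(ler_pM2l pos) -QE // -sumE;
  by apply: ler_sum => S /eqP /bound.
Qed.

End Symmetrization.

(** * Univariate polynomials of symmetric functions *)

Section SymmetricFunctions.
Local Open Scope ring_scope.
Variable F : rcfType.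
Implicit Types (Q : {poly F}) (g : nat -> bool) (m t : nat).

Definition gap_repr m g Q := forall j, (j <= m)%N ->
  if g j then 1 <= Q.[j%:R] else 0 <= Q.[j%:R] <= 1 / 9.

(** A lower bound on an absolute value need not survive averaging. Squaring first makes all bounds
    one-sided, at the cost of doubling the degree and turning [1 / 3] into [1 / 9]. *)
Lemma gap_repr_of_mpoly (m N : nat) g (p : {mpoly F[N]}) (x : {set 'I_m} -> 'I_N -> F) :
  (forall e, set_degree 1 (fun S => x S e)) ->
  (forall S : {set 'I_m}, if g #|S| then 1 <= `|p.@[x S]| else `|p.@[x S]| <= 1 / 3%:R) ->
  exists2 Q : {poly F}, (size Q <= (2 * (msize p).-1).+1)%N & gap_repr m g Q.
Proof.
move=> degx reprp; have := set_degreeX 2 (set_degree_meval p degx); rewrite mulnC.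
move=> /symmetrize[Q sizeQ QE]; exists Q => // j lejm.
case gj: (g j).
  apply: (QE j 1 lejm).1 => S cardS; have := reprp S; rewrite cardS gj => ge1.
  by rewrite -real_normK ?num_real // expr_ge1.
apply/andP; split.
  by apply: (QE j 0 lejm).1 => S _; rewrite sqr_ge0.
apply: (QE j (1 / 9) lejm).2 => S cardS; have := reprp S; rewrite cardS gj => le3.
rewrite -real_normK ?num_real // (_ : 1 / 9 = (1 / 3%:R) ^+ 2); last by field.
by rewrite lerXn2r ?nnegrE // divr_ge0.
Qed.

(** Otherwise [poly_gap], applied to [Q] shifted by [c], would give [Q(c) < 1]. *)
Lemma gap_repr_drop t m g Q (c : nat) : (0 < t)%N -> (size Q <= t.+1)%N ->
  gap_repr m g Q -> (c + 4 * t ^ 2 <= m)%N -> g c ->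
  exists2 j, (0 < j <= 4 * t ^ 2)%N & g (c + j)%N.
Proof.
move=> t_gt0 sizeQ reprQ lecm gc.
case: (boolP [exists j : 'I_(4 * t ^ 2).+1, (0 < j)%N && g (c + j)%N]).
  by case/existsP=> j /andP[j_gt0 gj]; exists j; rewrite // j_gt0 -ltnS /=.
rewrite negb_exists => /forallP no_j.
have hornerQ j : (Q \Po ('X + c%:R%:P)).[j%:R] = Q.[(c + j)%:R].
  by rewrite horner_comp hornerD hornerX hornerC natrD addrC.
suff : `|(Q \Po ('X + c%:R%:P)).[0]| < 1.
  have := hornerQ 0%N; rewrite mulr0n => ->; rewrite addn0.
  have := reprQ c; rewrite gc => /(_ (leq_trans (leq_addr _ _) lecm)) ge1.
  by rewrite ltNge (le_trans ge1 (ler_norm _)).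
apply: poly_gap t_gt0 _ _ => [|j /andP[j_gt0 lej]].
  by rewrite size_comp_poly2 // size_XaddC.
have /= := no_j (Ordinal (_ : j < (4 * t ^ 2).+1)%N); rewrite ltnS => /(_ lej).
rewrite j_gt0 /= => /negPf gj; have := reprQ (c + j)%N; rewrite gj hornerQ.
have -> : (c + j <= m)%N by apply: leq_trans lecm; rewrite leq_add2l.
by move=> /(_ isT) /andP[ge0 le9]; rewrite ger0_norm.
Qed.

Lemma gap_repr_run t m g Q Q' (c : nat) : (0 < t)%N ->
  (size Q <= t.+1)%N -> (size Q' <= t.+1)%N ->
  gap_repr m g Q -> gap_repr m (fun j => ~~ g j) Q' -> (c + 4 * t ^ 2 <= m)%N ->
  exists2 j, (0 < j <= 4 * t ^ 2)%N & g (c + j)%N = g c.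
Proof.
move=> t_gt0 sizeQ sizeQ' reprQ reprQ' lecm; case gc: (g c).
  exact: gap_repr_drop sizeQ reprQ lecm gc.
have [|j jle /negPf gj] := gap_repr_drop t_gt0 sizeQ' reprQ' lecm; first by rewrite gc.
by exists j.
Qed.

(** Intermediate value theorem: [Q] is at least 1 at one of [a], [b] and at most [1 / 9] at the
    other. *)
Lemma gap_repr_root m g Q (a b l u : nat) : gap_repr m g Q ->
  (l <= a <= u)%N -> (l <= b <= u)%N -> (u <= m)%N -> g a != g b ->
  exists2 x : F, l%:R <= x <= u%:R & root (Q - 2^-1%:P) x.
Proof.
wlog ga : a b / g a => [wlog|].
  have /orP[ga|/negPf nga] := orbN (g a); first exact: wlog.
  have /orP[gb|/negPf ngb] := orbN (g b); last by rewrite nga ngb.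
  by move=> reprQ lau lbu lum _; apply: (wlog b a); rewrite ?gb ?nga.
move=> reprQ lau lbu lum; rewrite ga; case gb: (g b) => // _.
have /andP[la au] := lau; have /andP[lb bu] := lbu.
have := reprQ a (leq_trans au lum); rewrite ga => Qa.
have := reprQ b (leq_trans bu lum); rewrite gb => /andP[_ Qb].
have [leab|/ltnW leba] := leqP a b.
- have [||x] := @poly_ivt F (2^-1%:P - Q) a%:R b%:R; rewrite ?ler_nat //.
    by apply/andP; split; rewrite !hornerE; lra.
  move=> /andP[ax xb] rx; exists x; last first.
    by rewrite -opprB rootN in rx.
  by rewrite (le_trans _ ax) ?ler_nat // (le_trans xb) ?ler_nat.
have [||x] := @poly_ivt F (Q - 2^-1%:P) b%:R a%:R; rewrite ?ler_nat //.
  by apply/andP; split; rewrite !hornerE; lra.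
move=> /andP[bx xa] rx; exists x => //.
by rewrite (le_trans _ bx) ?ler_nat // (le_trans xa) ?ler_nat.
Qed.

Lemma symmetric_gap_bound t m g Q Q' : (0 < t)%N ->
  (size Q <= t.+1)%N -> (size Q' <= t.+1)%N ->
  gap_repr m g Q -> gap_repr m (fun j => ~~ g j) Q' -> g 0%N != g 1%N ->
  (m < t.+1 * (4 * t ^ 2))%N.
Proof.
move=> t_gt0 sizeQ sizeQ' reprQ reprQ' g01.
set L := (4 * t ^ 2)%N; have L_ge4 : (4 <= L)%N by rewrite /L; nia.
have L_gt0 : (0 < L)%N by lia.
(* The number of complete windows of length [L] among the [m + 1] weights [0, ..., m]. *)
pose r := (m.+1 %/ L)%N.
suff le_rt : (r <= t)%N.
  have := ltn_ceil m.+1 L_gt0; rewrite -/r => lt_m.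
  by apply: leq_trans (ltnW lt_m) _; rewrite leq_mul2r ltnS le_rt orbT.
have [r0|r_gt0] := posnP r; first by rewrite r0.
have le_rm : (r * L <= m.+1)%N by exact: leq_divM.
(* Each closed window ends one before the next begins, so roots from different windows are
   distinct. *)
have windowP (i : 'I_r) : exists x : F,
    (i * L)%:R <= x <= (i.+1 * L).-1%:R /\ root (Q - 2^-1%:P) x.
  have le_iL : ((i.+1 * L).-1 <= m)%N.
    have : (i.+1 * L <= m.+1)%N by rewrite (leq_trans _ le_rm) // leq_mul2r ltn_ord orbT.
    by lia.
  have [a [b [lau lbu gab]]] : exists a b, [/\ (i * L <= a <= (i.+1 * L).-1)%N,
      (i * L <= b <= (i.+1 * L).-1)%N & g a != g b].
    case: (boolP [exists s : 'I_L, g (i * L + s)%N != g (i * L)%N]).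
      case/existsP=> s gs; exists (i * L + s)%N, (i * L)%N.
      by have := ltn_ord s; rewrite !mulSn; split=> //; lia.
    rewrite negb_exists => /forallP const.
    have {}const j : (i * L <= j <= (i.+1 * L).-1)%N -> g j = g (i * L)%N.
      move=> ij; have lt_s : (j - i * L < L)%N by move: ij; rewrite mulSn; lia.
      have /= := const (Ordinal lt_s); rewrite negbK => /eqP.
      by rewrite subnKC //; case/andP: ij.
    have [i0|i_gt0] := posnP i.
      exists 0%N, 1%N; rewrite i0 mul0n mul1n; split=> //; lia.
    have L_lt : (L <= i * L)%N by rewrite leq_pmull.
    (* If window [i > 0] is constant, let [c] be the last earlier weight with the other value;
       weight 0 or 1 shows that one exists. From [c + 1] to the end of the window [g] differs from
       [g c], a run of at least [L] weights, contradicting [gap_repr_run]. *)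
    pose P c := (c < i * L)%N && (g c != g (i * L)%N).
    have exP : exists c, P c.
      case g0: (g 0%N == g (i * L)%N); last by exists 0%N; rewrite /P g0; lia.
      by exists 1%N; rewrite /P -(eqP g0) eq_sym g01; lia.
    have ubP c : P c -> (c <= i * L)%N by case/andP=> /ltnW.
    case: (ex_maxnP exP ubP) => c /andP[lt_c gc] maxc.
    have [|j /andP[j_gt0 leL] gcj] :=
      @gap_repr_run t m g Q Q' c t_gt0 sizeQ sizeQ' reprQ reprQ'.
      by rewrite -/L; move: le_iL; rewrite mulSn; lia.
    move: gc; rewrite -gcj => /negP[]; apply/eqP.
    have [lt_cj|le_cj] := ltnP (c + j) (i * L); last first.
      by apply: const; rewrite le_cj mulSn; lia.
    apply/eqP; apply: contraT => neq.
    have := maxc (c + j)%N; rewrite /P lt_cj neq => /(_ isT); lia.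
  by have [x] := gap_repr_root reprQ lau lbu le_iL gab; exists x.
have [x xP] := fin_all_exists windowP.
have x_inj : injective x.
  have lt_x (i j : 'I_r) : (i < j)%N -> x i < x j.
    move=> lt_ij; have [/andP[_ xi] _] := xP i; have [/andP[xj _] _] := xP j.
    apply: le_lt_trans xi (lt_le_trans _ xj).
    rewrite ltr_nat; have : (i.+1 * L <= j * L)%N by rewrite leq_mul2r lt_ij orbT.
    by rewrite mulSn; lia.
  move=> i j eq_x; apply: val_inj => /=.
  by case: (ltngtP i j) => // /lt_x; rewrite eq_x ltxx.
have nzQ : Q - 2^-1%:P != 0.
  apply/eqP => /(congr1 (fun q : {poly F} => q.[0])).
  have := reprQ 0%N isT; rewrite mulr0n !hornerE.
  by case: (g 0%N) => [|/andP[]]; lra.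
have := max_poly_roots nzQ (rs := codom x).
rewrite size_codom card_ord => lt_r; rewrite -ltnS.
apply: leq_trans (lt_r _ _) _; last 1 first.
- rewrite (leq_trans (size_polyD _ _)) // geq_max sizeQ size_polyN.
  by rewrite (leq_trans (size_polyC_leq1 _)).
- by apply/allP => _ /codomP[i ->]; case: (xP i).
by rewrite map_inj_uniq ?enum_uniq.
Qed.

End SymmetricFunctions.

(** * Hypergraph properties *)

Section FinitePermutations.

(** The permutation follows [pi] on the image of [phi] and fixes every other point. In this way a
    permutation of disjoint copies acts on all vertices. *)
Lemma extend_inj_perm (I T : finType) (phi : I -> T) (pi : I -> I) :
  injective phi -> injective pi ->
  exists s : {perm T}, forall a, s (phi a) = phi (pi a).
Proof.
move=> phi_inj pi_inj.
pose f x := if [pick a | phi a == x] is Some a then phi (pi a) else x.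
have fE a : f (phi a) = phi (pi a).
  by rewrite /f; case: pickP => [b /eqP/phi_inj->//|/(_ a)]; rewrite eqxx.
have f_out x : (forall a, phi a != x) -> f x = x.
  by rewrite /f; case: pickP => // a /eqP <- /(_ a); rewrite eqxx.
have phiP x : (exists a, x = phi a) \/ (forall a, phi a != x).
  case: (pickP (fun a => phi a == x)) => [a /eqP <-|no_a]; first by left; exists a.
  by right=> a; rewrite no_a.
suff f_inj : injective f by exists (perm f_inj) => a; rewrite permE fE.
have phi_pi a : exists b, a = pi b.
  by have [pi' _ piK] := injF_bij pi_inj; exists (pi' a); rewrite piK.
move=> x y; case: (phiP x) => [[a ->]|outx]; case: (phiP y) => [[b ->]|outy].
- by rewrite !fE => /phi_inj/pi_inj->.
- by rewrite fE f_out // => eq_y; have := outy (pi a); rewrite eq_y eqxx.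
- by rewrite fE f_out // => eq_x; have := outx (pi b); rewrite eq_x eqxx.
by rewrite !f_out.
Qed.

(** Listing [A] first serves twice: matching positions in two such lists carries one set onto
    another of equal size, and cutting the list into blocks yields disjoint copies of [A]. *)
Definition enum_split (T : finType) (A : {set T}) := enum A ++ enum (~: A).

Lemma mem_enum_split (T : finType) (A : {set T}) x : x \in enum_split A.
Proof. by rewrite mem_cat !mem_enum inE orbN. Qed.

Lemma enum_split_uniq (T : finType) (A : {set T}) : uniq (enum_split A).
Proof.
rewrite cat_uniq !enum_uniq andbT /=; apply/hasPn => x.
by rewrite !mem_enum inE.
Qed.

Lemma size_enum_split (T : finType) (A : {set T}) : size (enum_split A) = #|T|.
Proof. by rewrite size_cat -!cardE cardsC. Qed.

Lemma perm_set_eq_card (T : finType) (A B : {set T}) :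
  #|A| = #|B| -> exists s : {perm T}, s @: A = B.
Proof.
move=> eq_card; pose f x := nth x (enum_split B) (index x (enum_split A)).
have idx x (C : {set T}) : index x (enum_split A) < size (enum_split C).
  by rewrite size_enum_split -(size_enum_split A) index_mem mem_enum_split.
have f_inj : injective f.
  move=> x y; rewrite /f (set_nth_default y) // => /eqP.
  rewrite nth_uniq ?enum_split_uniq // => /eqP eq_idx.
  by rewrite -[x](nth_index x (mem_enum_split A x)) eq_idx nth_index ?mem_enum_split.
exists (perm f_inj); apply/eqP.
rewrite eqEcard card_imset ?eq_card ?leqnn ?andbT; last exact: perm_inj.
apply/subsetP => _ /imsetP[x xA ->]; rewrite permE /f.
have lt_idx : index x (enum_split A) < size (enum B).
  by rewrite -cardE -eq_card cardE index_cat mem_enum xA index_mem mem_enum.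
by rewrite nth_cat lt_idx -mem_enum mem_nth.
Qed.

(** The list [enum_split V] is cut into consecutive blocks of length [#|V|], of which block 0 lists
    [V]. Quotient and remainder of a position by [#|V|] recover the block and the place in it. *)
Lemma disjoint_copies (n m : nat) (V : {set 'I_n}) : 0 < m -> m * #|V| <= n ->
  exists (i0 : 'I_m) (phi : 'I_m -> 'I_#|V| -> 'I_n),
    i0 = 0 :> nat /\ (forall i r j s, phi i r = phi j s -> i = j /\ r = s) /\
    (forall x, x \in V -> exists r, phi i0 r = x).
Proof.
move=> m_gt0 le_n; exists (Ordinal m_gt0).
(* [enum_val r] is only a default: all positions are below [m * #|V| <= n]. *)
exists (fun i r => nth (enum_val r) (enum_split V) (i * #|V| + r)).
split=> //; split=> [i r j s|x xV].
  have lt_size (i' : 'I_m) (r' : 'I_#|V|) : i' * #|V| + r' < size (enum_split V).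
    rewrite size_enum_split card_ord; apply: leq_trans le_n.
    apply: (@leq_trans (i'.+1 * #|V|)); last by rewrite leq_mul2r ltn_ord orbT.
    by rewrite mulSn addnC ltn_add2r.
  rewrite (set_nth_default (enum_val s)) // => /eqP.
  rewrite nth_uniq ?enum_split_uniq // => /eqP eq_pos.
  have V_gt0 : 0 < #|V| by exact: leq_ltn_trans (ltn_ord r).
  split; apply: val_inj.
    by have := congr1 (divn^~ #|V|) eq_pos; rewrite !divnMDl // !divn_small ?addn0.
  by have := congr1 (modn^~ #|V|) eq_pos; rewrite !modnMDl !modn_small.
exists (enum_rank_in xV x); rewrite /= mul0n add0n /enum_split nth_cat -cardE ltn_ord.
by rewrite -enum_val_nth enum_rankK_in.
Qed.

End FinitePermutations.

(** * Cubes embedded in the space of hypergraphs *)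

Section Embeddings.
Variables (n k : nat).
Implicit Types (P : hypergraph n k -> bool) (G : hypergraph n k).

(* Every coordinate is a constant ([A] empty), a bit, or a negated bit. *)
Definition literal_embedding (m : nat) (X : {set 'I_m} -> hypergraph n k) :=
  forall e, exists (A : {set 'I_m}) (h : bool -> bool),
    #|A| <= 1 /\ forall S, X S e = h (A \subset S).

Lemma gap_repr_of_Nrepr (m : nat) P p (X : {set 'I_m} -> hypergraph n k) (g : nat -> bool) :
  Nrepr P p -> literal_embedding X -> (forall S, P (X S) = g #|S|) ->
  exists2 Q : {poly R}, size Q <= (2 * mdegree p).+1 & gap_repr m g Q.
Proof.
move=> reprP litX PX.
apply: (gap_repr_of_mpoly (x := fun S => hg_point (X S))) => [i|S]; last first.
  by rewrite -PX; apply: reprP.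
have [A [h [A_le1 XE]]] := litX (enum_val i).
apply: (@set_degree_eq R m 1 (fun S => (h (A \subset S) : nat)%:R%R)) => [S|].
  by rewrite /hg_point XE.
exact: (set_degree_subset_fun (fun b => (h b : nat)%:R%R) A_le1).
Qed.

Definition edges G := [set e | G e].
Definition hg0 : hypergraph n k := [ffun=> false].

(** [G] has the fewest edges among the hypergraphs whose value differs from that of [hg0]; a proper
    subhypergraph has fewer, so it keeps the value of [hg0]. *)
Lemma minimal_change P : nonconstant P ->
  exists2 G, P G != P hg0 &
    forall H : hypergraph n k, (forall e, H e -> G e) -> H != G -> P H = P hg0.
Proof.
move=> [H1 [H2 neqP]].
have [H PH] : exists H, P H != P hg0.
  case: (eqVneq (P H1) (P hg0)) => [eq1|]; last by exists H1.
  by exists H2; rewrite -eq1 eq_sym.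
case: (@arg_minnP _ H (fun G => P G != P hg0) (fun G => #|edges G|) PH) => G PG minG.
exists G => // H' subH' neqH'; apply/eqP; apply: contraNT neqH' => PH'.
have eq_edges : edges H' = edges G.
  apply/eqP; rewrite eqEcard minG // andbT.
  by apply/subsetP => e; rewrite !inE => /subH'.
by apply/eqP/ffunP => e; have /setP/(_ e) := eq_edges; rewrite !inE.
Qed.

Section Bounds.
Variables (P : hypergraph n k -> bool) (t : nat) (p q : {mpoly R[nvars n k]}).
Hypotheses (t_gt0 : 0 < t) (reprp : Nrepr P p) (reprq : Nrepr (fun H => ~~ P H) q).
Hypotheses (degp : 2 * mdegree p <= t) (degq : 2 * mdegree q <= t).

Lemma gap_repr_pair (m : nat) (X : {set 'I_m} -> hypergraph n k) (g : nat -> bool) :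
  literal_embedding X -> (forall S, P (X S) = g #|S|) ->
  exists Q Q' : {poly R}, [/\ size Q <= t.+1, size Q' <= t.+1, gap_repr m g Q &
    gap_repr m (fun j => ~~ g j) Q'].
Proof.
move=> litX PX.
have [Q sizeQ reprQ] := gap_repr_of_Nrepr reprp litX PX.
have [|Q' sizeQ' reprQ'] := gap_repr_of_Nrepr (g := fun j => ~~ g j) reprq litX.
  by move=> S; rewrite PX.
by exists Q, Q'; split=> //; [apply: leq_trans sizeQ _|apply: leq_trans sizeQ' _]; rewrite ltnS.
Qed.

Lemma card_minimal_change G : P G != P hg0 ->
  (forall H : hypergraph n k, (forall e, H e -> G e) -> H != G -> P H = P hg0) ->
  #|edges G| < 4 * t ^ 2.
Proof.
move=> PG minG; rewrite ltnNge; apply/negP => le_edges.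
(* The bits in [S] mark deleted edges, so weight 0 is [G] itself. [A e] is the singleton of the
   index of [e] when [e] is an edge of [G], and is empty otherwise. *)
pose A e := [set i : 'I_#|edges G| | enum_val i == e].
pose X (S : {set 'I_#|edges G|}) : hypergraph n k := [ffun e => G e && ~~ (A e \subset S)].
pose g j := if j == 0 then P G else P hg0.
have litX : literal_embedding X.
  move=> e; exists (A e), (fun b => G e && ~~ b); split=> [|S]; last by rewrite ffunE.
  apply/card_le1_eqP => i j; rewrite !inE => /eqP <- /eqP; exact: enum_val_inj.
have PX S : P (X S) = g #|S|.
  rewrite /g cards_eq0; case: (set_0Vmem S) => [->|[i iS]].
    rewrite eqxx; congr (P _); apply/ffunP => e; rewrite ffunE subset0.
    case Ge: (G e) => //=; have e_in : e \in edges G by rewrite inE.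
    apply/set0Pn; exists (enum_rank_in e_in e).
    by rewrite inE enum_rankK_in.
  have -> : (S == set0) = false by apply/negbTE/set0Pn; exists i.
  apply: minG => [e|]; first by rewrite ffunE => /andP[].
  apply/eqP => /ffunP/(_ (enum_val i)); rewrite ffunE.
  have := enum_valP i; rewrite inE => -> /=.
  suff -> : A (enum_val i) \subset S by [].
  by apply/subsetP => j; rewrite inE => /eqP/enum_val_inj->.
have [Q [Q' [sizeQ sizeQ' reprQ reprQ']]] := gap_repr_pair litX PX.
have [|j /andP[j_gt0 _]] := gap_repr_run (c := 0) t_gt0 sizeQ sizeQ' reprQ reprQ'.
  by [].
by rewrite add0n /g eqxx gtn_eqF // => /eqP; rewrite eq_sym (negPf PG).
Qed.

Definition vertices G := \bigcup_(e in edges G) val e.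

Lemma card_vertices G : #|vertices G| <= k * #|edges G|.
Proof.
rewrite mulnC -sum_nat_const /vertices.
elim/big_rec2: _ => [|e c A _ leAc]; first by rewrite cards0.
by rewrite (leq_trans (leq_card_setU _ _)) // (eqP (valP e)) leq_add2l.
Qed.

(** Switching whole copies of [G] on and off embeds the [m]-cube. Permutations of the copies come
    from vertex permutations, so [P] depends only on the number of copies present. *)
Lemma disjoint_copies_bound G (m : nat) : 0 < k -> hg_property P -> P G != P hg0 ->
  0 < m -> m * #|vertices G| <= n -> m < t.+1 * (4 * t ^ 2).
Proof.
move=> k_gt0 symP PG m_gt0 le_n.
have [i0 [phi [i0_0 [phi_inj phi0]]]] := disjoint_copies m_gt0 le_n.
have phi_inj2 i : injective (phi i) by move=> r s /phi_inj[].
pose copy i (f e : ksub n k) := [exists e0 : {set 'I_#|vertices G|},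
  (val f == phi i0 @: e0) && (val e == phi i @: e0)].
pose A e := [set i | [exists f, G f && copy i f e]].
(* [A e] collects the copies having [e] as an edge. Since [k > 0], [e] has a vertex, which lies in a
   single copy. *)
have A_le1 e : #|A e| <= 1.
  apply/card_le1_eqP => i j; rewrite !inE.
  move=> /existsP[f /andP[_ /existsP[e0 /andP[_ /eqP eE]]]].
  move=> /existsP[f' /andP[_ /existsP[e0' /andP[_ /eqP eE']]]].
  have : 0 < #|val e| by rewrite (eqP (valP e)).
  case/card_gt0P => x xe; have := xe; rewrite {1}eE => /imsetP[r _ xE].
  by move: xe; rewrite eE' xE => /imsetP[s _ /phi_inj[]].
(* The condition [A e != set0] excludes the edges in no copy, for which the inclusion holds
   trivially. *)
pose X (S : {set 'I_m}) : hypergraph n k := [ffun e => (A e != set0) && (A e \subset S)].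
have litX : literal_embedding X.
  by move=> e; exists (A e), (fun b => (A e != set0) && b); split=> // S; rewrite ffunE.
pose g j := P (X [set i : 'I_m | i < j]).
have isoX (S S' : {set 'I_m}) : #|S| = #|S'| -> P (X S) = P (X S').
  move=> /perm_set_eq_card[s <-]; apply: symP.
  have [||u uE] := @extend_inj_perm _ _ (fun a => phi a.1 a.2) (fun a => (s a.1, a.2)).
  - by move=> [i r] [j r'] /phi_inj /= [-> ->].
  - by move=> [i r] [j r'] /= [/perm_inj-> ->].
  have uphi i (e0 : {set 'I_#|vertices G|}) : u @: (phi i @: e0) = phi (s i) @: e0.
    by rewrite -imset_comp; apply: eq_imset => r; rewrite /= (uE (i, r)).
  have Au e : A (ksub_perm u e) = s @: A e.
    apply/setP => j; have [i ->] : exists i, j = s i by exists (s^-1 j)%g; rewrite permKV.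
    rewrite mem_imset; last exact: perm_inj.
    rewrite !inE; apply: eq_existsb => f; congr (_ && _); apply: eq_existsb => e0.
    by congr (_ && _); rewrite /= -uphi (inj_eq (imset_inj perm_inj)).
  exists u => e; rewrite !ffunE Au imset_eq0; congr (_ && _).
  apply/idP/idP => [/imsetS->//|/subsetP sub]; apply/subsetP => i iA.
  by have := sub _ (imset_f s iA); rewrite mem_imset //; exact: perm_inj.
have PX S : P (X S) = g #|S|.
  have le_m : #|S| <= m by rewrite -[leqRHS]card_ord max_card.
  apply: isoX; rewrite [RHS]cardsE -[RHS]sum1_card (big_ord_narrow le_m).
  by rewrite sum_nat_const card_ord muln1.
have g0 : g 0 = P hg0.
  have no_i : [set i : 'I_m | i < 0] = set0 by apply/setP => i; rewrite !inE.
  by congr (P _); apply/ffunP => e; rewrite !ffunE no_i subset0 andNb.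
have g1 : g 1 = P G.
  congr (P _); apply/ffunP => e; rewrite ffunE.
  have -> : (A e != set0) && (A e \subset [set i : 'I_m | i < 1]) = (i0 \in A e).
    apply/andP/idP => [[/set0Pn[i iA] /subsetP/(_ i iA)]|i0A].
      by rewrite inE => i_lt1; rewrite (_ : i0 = i) //; apply: val_inj => /=; lia.
    split; first by apply/set0Pn; exists i0.
    by apply/subsetP => i iA; rewrite (card_le1_eqP (A_le1 e) i0 i i0A iA) inE i0_0.
  rewrite inE; apply/existsP/idP => [[f /andP[Gf /existsP[e0 /andP[/eqP fE /eqP eE]]]]|Ge].
    by rewrite (_ : e = f) //; apply: val_inj; rewrite fE eE.
  (* The labels of [e] are its preimage under [phi i0]; the vertices of [e] all lie in [vertices G],
     which [phi i0] covers. *)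
  exists e; rewrite Ge; apply/existsP; exists (phi i0 @^-1: val e); rewrite andbb.
  apply/eqP/setP => x; apply/idP/imsetP => [xe|[r + ->]]; last by rewrite inE.
  have [|r xE] := phi0 x; first by apply/bigcupP; exists e; rewrite ?inE.
  by exists r; rewrite // inE xE.
have [Q [Q' [sizeQ sizeQ' reprQ reprQ']]] := gap_repr_pair litX PX.
apply: (symmetric_gap_bound t_gt0 sizeQ sizeQ' reprQ reprQ').
by rewrite g0 g1 eq_sym.
Qed.

End Bounds.

(** The sum over accepted [H] of the products of literals that vanish at every other hypergraph
    takes exactly the values of [P]. *)
Lemma Nrepr_exists P : exists p, Nrepr P p.
Proof.
pose lit (H : hypergraph n k) (i : 'I_(nvars n k)) : {mpoly R[nvars n k]} :=
  (if H (enum_val i) then 'X_i else 1 - 'X_i)%R.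
exists (\sum_(H : hypergraph n k | P H) \prod_i lit H i)%R => H.
have -> : ((\sum_(H : hypergraph n k | P H) \prod_i lit H i).@[hg_point H] = (P H)%:R)%R.
  rewrite rmorph_sum /=.
  have litE H' : ((\prod_i lit H' i).@[hg_point H] = (H' == H)%:R)%R.
    rewrite rmorph_prod /=.
    have valE i : ((lit H' i).@[hg_point H] = (H' (enum_val i) == H (enum_val i))%:R)%R.
      rewrite /lit /hg_point; case: ifP => _; rewrite ?mevalB ?meval1 mevalXU.
        by case: (H _).
      by case: (H _); rewrite ?subrr ?subr0.
    under eq_bigr do rewrite valE.
    case: eqVneq => [->|neqH]; first by rewrite big1 // => i _; rewrite eqxx.
    have [e neq_e] : exists e, H' e != H e.
      apply/existsP; rewrite -negb_forall; apply: contra neqH => /forallP eqH.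
      by apply/eqP/ffunP => e; apply/eqP.
    by rewrite (bigD1 (enum_rank e)) //= enum_rankK (negPf neq_e) mul0r.
  under eq_bigr do rewrite litE.
  case PH: (P H); last first.
    by rewrite big1 // => H' PH'; case: eqP => // eqH; rewrite eqH PH in PH'.
  by rewrite (bigD1 H) //= eqxx big1 ?addr0 // => H' /andP[_ /negPf->].
by case: (P H); rewrite ?normr1 ?normr0 ?lexx // divr_ge0.
Qed.

(** Descent on the degree; excluded middle decides whether a representing polynomial of smaller
    degree exists. *)
Lemma is_N_exists P : exists d, is_N P d.
Proof.
have [p0 repr0] := Nrepr_exists P.
have [d] := ubnP (mdegree p0); elim: d p0 repr0 => // d IH p reprp; rewrite ltnS => led.
case: (classic (exists q, Nrepr P q /\ mdegree q < mdegree p)).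
  by move=> [q [reprq ltq]]; apply: (IH q) => //; apply: leq_trans ltq led.
move=> no_q; exists (mdegree p); split=> [|q reprq]; first by exists p.
by rewrite leqNgt; apply/negP => ltq; apply: no_q; exists q.
Qed.

End Embeddings.

(** * The lower bound *)

Lemma order_lt_repr n k (P : hypergraph n k -> bool) t p q :
  0 < k -> 0 < t -> hg_property P -> nonconstant P ->
  Nrepr P p -> Nrepr (fun H => ~~ P H) q -> 2 * mdegree p <= t -> 2 * mdegree q <= t ->
  n < 32 * k * t ^ 5.
Proof.
move=> k_gt0 t_gt0 symP /minimal_change[G PG minG] reprp reprq degp degq.
have lt_edges := card_minimal_change t_gt0 reprp reprq degp degq PG minG.
have le_v := card_vertices G.
have v_gt0 : 0 < #|vertices G|.
  have [e Ge] : exists e, G e.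
    apply/existsP; apply: contraNT PG; rewrite negb_exists => /forallP noG.
    by apply/eqP; congr (P _); apply/ffunP => e; rewrite ffunE; apply/negbTE.
  have : 0 < #|val e| by rewrite (eqP (valP e)).
  case/card_gt0P => x xe; apply/card_gt0P; exists x.
  by apply/bigcupP; exists e; rewrite ?inE.
have lt_m : n %/ #|vertices G| < t.+1 * (4 * t ^ 2).
  have [->|m_gt0] := posnP (n %/ #|vertices G|).
    by rewrite muln_gt0 /= muln_gt0 expn_gt0 t_gt0.
  apply: (disjoint_copies_bound t_gt0 reprp reprq degp degq k_gt0 symP PG m_gt0).
  exact: leq_divM.
apply: leq_trans (ltn_ceil n v_gt0) _.
(* The two factors bound the number of blocks and the size of a block; [32 = 2 * 4 * 4], with the 2
   from [t + 1 <= 2 t]. *)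
apply: (@leq_trans (t.+1 * (4 * t ^ 2) * (k * (4 * t ^ 2)))).
  by rewrite leq_mul // (leq_trans le_v) // leq_mul2l (ltnW lt_edges) orbT.
have -> : 32 * k * t ^ 5 = 2 * t * (4 * t ^ 2) * (k * (4 * t ^ 2)) by ring.
by rewrite !leq_mul2r; apply/orP; right; apply/orP; right; lia.
Qed.

Lemma Rpower_sixth_le (n y : nat) : (0 < n)%N -> (0 < y)%N -> (n <= y ^ 6)%N ->
  Rle (Rpower (INR n) (Rdiv 1 6)) (INR y).
Proof.
move=> n_gt0 y_gt0 le_n.
have pos_y : Rlt 0 (INR y) by apply: lt_0_INR; lia.
have -> : INR y = Rpower (Rpower (INR y) (INR 6)) (Rdiv 1 6).
  rewrite Rpower_mult (_ : Rmult (INR 6) (Rdiv 1 6) = IZR 1) ?Rpower_1 //.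
  rewrite INR_IZR_INZ [Z.of_nat 6]/=; Lra.lra.
apply: Rle_Rpower_l; first by Lra.lra.
rewrite Rpower_pow //; split; first by apply: lt_0_INR; lia.
rewrite -pow_INR; apply: le_INR. apply/ssrnat.leP.
by rewrite (_ : Nat.pow y 6 = y ^ 6) // !expnS expn0.
Qed.

Theorem theorem3p28 :
  forall k : nat, (1 <= k)%N ->
  exists c : R, (0 < c)%R /\ exists n0 : nat,
  forall n : nat, (n0 <= n)%N ->
  forall P : hypergraph n k -> bool,
    hg_property P -> nonconstant P ->
    exists d1 d2 : nat,
      is_N P d1 /\ is_N (fun H => ~~ P H) d2 /\
      (c * Rpower (INR n) (1 / 6) <= INR (maxn d1 d2))%R.
Proof.
(* With [2 M + 1 <= 3 M], the bound [32 k (3 M)^6 <= (96 k M)^6] explains the constant. *)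
move=> k k_gt0; exists ((96 * k)%:R^-1)%R; split.
  by rewrite invr_gt0 ltr0n muln_gt0.
(* This threshold rules out [M = 0], for which the bound below would read [n < 32 k]. *)
exists (32 * k) => n le_n P symP nonP.
have [d1 N1] := is_N_exists P; have [d2 N2] := is_N_exists (fun H => ~~ P H).
exists d1, d2; split=> //; split=> //.
have [[p [reprp degp]] _] := N1; have [[q [reprq degq]] _] := N2.
set M := maxn d1 d2.
(* The choice [t = 2 M + 1] is positive even before [M > 0] is known. *)
have lt_n : n < 32 * k * (2 * M).+1 ^ 5.
  apply: order_lt_repr k_gt0 _ symP nonP reprp reprq _ _ => //;
    by rewrite ?degp ?degq leqW // leq_mul2l ?leq_maxl ?leq_maxr.
have M_gt0 : 0 < M.
  by rewrite lt0n; apply: contraTneq lt_n => ->; rewrite muln0 exp1n muln1 -leqNgt.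
rewrite mulrC ler_pdivrMr ?ltr0n ?muln_gt0 //.
have le_n6 : n <= (M * (96 * k)) ^ 6.
  apply: leq_trans (ltnW lt_n) _.
  apply: (@leq_trans (32 * k * (3 * M) ^ 6)).
    rewrite leq_mul2l; apply/orP; right; apply: (@leq_trans ((3 * M) ^ 5)).
      by rewrite leq_exp2r //; lia.
    by rewrite leq_exp2l //; lia.
  rewrite (_ : M * (96 * k) = (32 * k) * (3 * M)); last by ring.
  by rewrite [leqRHS]expnMn leq_mul2r -{1}[32 * k]expn1 leq_exp2l ?orbT //; lia.
have n_gt0 : 0 < n by apply: leq_trans le_n; rewrite muln_gt0.
have y_gt0 : 0 < M * (96 * k) by rewrite !muln_gt0 M_gt0.
have /RleP := Rpower_sixth_le n_gt0 y_gt0 le_n6.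
by rewrite [X in (_ <= X)%R]INRE natrM -(INRE M).
Qed.
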